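(* Let $\mathbb{X}$ be a tangent category with negatives and let $(q:E\to M,\xi,\lambda)$ be a differential bundle in $\mathbb{X}$. Assume that the pullback $T_M(E)$ of $p:TE\to E$ along $\xi:M\to E$ exists, with projections $\pi_M:T_M(E)\to M$ and $\iota_M:T_M(E)\to TE$ (so $p\iota_M=\xi\pi_M$), that $\pi_M$ is a differential bundle with lift $\lambda_M$, and that $(\iota_M,\xi)$ is a linear morphism of differential bundles from $\pi_M$ to $p:TE\to E$ (with lift $\ell$), i.e. $T(\iota_M)\lambda_M=\ell\iota_M$. Let $\chi:T_M(E)\to T_M(E)$ be the idempotent uniquely determined by $\iota_M\chi=\iota_M-_pT(\xi q)\iota_M$, let $(\lambda,q):E\to T_M(E)$ be the morphism with $\iota_M(\lambda,q)=\lambda$ and $\pi_M(\lambda,q)=q$, and let $K:T_M(E)\to E$ be the factorisation of $\chi$ through $(\lambda,q)$, i.e. $(\lambda,q)K=\chi$. Then $K$ and $(\lambda,q)$ exhibit $q$ as a retract of $\pi_M$ over the fixed base $M$: $qK=\pi_M$, $\pi_M(\lambda,q)=q$ and $K(\lambda,q)=\mathrm{id}_E$.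
   Context: Conventions. Composition is applicative: $gf$ means first $f$, then $g$. For $q:E\to M$, $E_n$ is the $n$-fold fibre product of $E$ over $M$, with projections $\pi_i$. An additive bundle is a commutative monoid $(q:E\to M,\ +_q:E_2\to E,\ \xi:M\to E)$ in the slice category $\mathbb{X}/M$. A morphism of additive bundles is a commutative square $(f_1,f_0)$ from $q$ to $q'$ with $f_1(a+_qb)=f_1a+_{q'}f_1b$ and $f_1\xi=\xi'f_0$. For an endofunctor $T$, a $T$-limit (e.g. $T$-pullback) is a limit diagram preserved by $T^n$ for every $n\geq 0$. If $q$ is an additive bundle whose fibre powers are $T$-limits, $T(q)$ is an additive bundle with addition $+_{T(q)}=T(+_q)$ and zero $T(\xi)$. A tangent category is a category $\mathbb{X}$ with an endofunctor $T$; a natural transformation $p:T\Rightarrow\mathrm{id}$ whose $n$-fold fibre powers $T_n(M)$ of $p_M$ exist and are $T$-limits; and natural transformations $0:\mathrm{id}\Rightarrow T$, $+:T_2\Rightarrow T$, $\ell:T\Rightarrow T^2$, $c:T^2\Rightarrow T^2$ such that: each $(p_M,+_M,0_M)$ is an additive bundle; $(\ell,0):(TM,p)\to(T^2M,T(p))$ and $(c,\mathrm{id}):(T^2M,T(p))\to(T^2M,p)$ are additive bundle morphisms; $c^2=\mathrm{id}$, $c\ell=\ell$, $T(\ell)\ell=\ell\ell$, $cT(c)c=T(c)cT(c)$, $T(\ell)c=cT(c)\ell$; and the square with top $\ell\pi_0+_{T(p)}0\pi_1:T_2(M)\to T^2(M)$, left $p\pi_0=p\pi_1:T_2(M)\to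 M$, right $T(p):T^2(M)\to T(M)$, bottom $0:M\to T(M)$ is a $T$-pullback. It has negatives if there is a natural transformation $-:T\Rightarrow T$ making each $(p_M,0_M,+_M)$ an abelian group bundle; then $a-_pb:=a+_p(-b)$. A pre-differential bundle is a triple $(q:E\to M,\xi:M\to E,\lambda:E\to TE)$ with $q\xi=\mathrm{id}$, $\ell\lambda=T(\lambda)\lambda$, $p\lambda=\xi q$, $\lambda\xi=0\xi$. A differential bundle is a pre-differential bundle $(q,\xi,\lambda)$ with an addition $+_q:E_2\to E$ such that: the $n$-fold fibre powers of $q$ exist and are $T$-limits; $(q,+_q,\xi)$ is an additive bundle; $(\lambda,0):(E,q)\to(TE,T(q))$ and $(\lambda,\xi):(E,q)\to(TE,p)$ are additive bundle morphisms; and the square with top $\lambda\pi_0+_{T(q)}0\pi_1:E_2\to TE$, left $q\pi_0=q\pi_1:E_2\to M$, right $T(q):TE\to TM$, bottom $0:M\to TM$ is a $T$-pullback. *)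

(* Defs.v *)
From mathcomp Require Import all_boot.

Set Implicit Arguments.
Unset Strict Implicit.
Unset Printing Implicit Defensive.

(* Universal properties are Type-valued records carrying their mediating map,  *)
(* so that the sums [a +_q b] are terms; [g ∘ f] is first [f], then [g].       *)

Declare Scope cat_scope.
Delimit Scope cat_scope with cat.
Open Scope cat_scope.

Reserved Notation "g ∘ f" (at level 40, left associativity).

Record category : Type := Category {
  obj :> Type;
  hom : obj -> obj -> Type;
  idm : forall a : obj, hom a a;
  comp : forall a b c : obj, hom b c -> hom a b -> hom a c
    where "g ∘ f" := (comp g f);
  comp_idl : forall (a b : obj) (f : hom a b), idm b ∘ f = f;
  comp_idr : forall (a b : obj) (f : hom a b), f ∘ idm a = f;
  comp_assoc : forall (a b c d : obj) (h : hom c d) (g : hom b c) (f : hom a b),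
    h ∘ (g ∘ f) = h ∘ g ∘ f }.

Arguments idm {c} a : rename.
Notation "g ∘ f" := (comp g f) : cat_scope.
Notation "a ~> b" := (hom a b) (at level 99, b at level 200) : cat_scope.

Record endofunctor (C : category) : Type := Endofunctor {
  fobj :> C -> C;
  fmap : forall a b : C, (a ~> b) -> (fobj a ~> fobj b);
  fmap_id : forall a : C, fmap (idm a) = idm (fobj a);
  fmap_comp : forall (a b c : C) (g : b ~> c) (f : a ~> b),
    fmap (g ∘ f) = fmap g ∘ fmap f }.

Definition functor_id (C : category) : endofunctor C :=
  @Endofunctor C (fun a => a) (fun a b f => f)
    (fun a => erefl) (fun a b c g f => erefl).

Definition functor_comp (C : category) (F G : endofunctor C) : endofunctor C :=
  @Endofunctor C (fun a => F (G a)) (fun a b f => fmap F (fmap G f))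
    (fun a => etrans (congr1 (@fmap C F _ _) (fmap_id G a)) (fmap_id F (G a)))
    (fun a b c g f =>
       etrans (congr1 (@fmap C F _ _) (fmap_comp G g f))
              (fmap_comp F (fmap G g) (fmap G f))).

Fixpoint functor_iter (C : category) (F : endofunctor C) (k : nat) :
    endofunctor C :=
  if k is k'.+1 then functor_comp F (functor_iter F k') else functor_id C.

(* The square [f ∘ a = g ∘ b] is a pullback of [f] along [g]. *)
Record isPullback (C : category) (P A B D : C) (f : A ~> D) (g : B ~> D)
    (a : P ~> A) (b : P ~> B) : Type := IsPullback {
  pb_comm : f ∘ a = g ∘ b;
  pb_pair : forall (X : C) (u : X ~> A) (v : X ~> B), f ∘ u = g ∘ v -> (X ~> P);
  pb_pair1 : forall (X : C) (u : X ~> A) (v : X ~> B) (h : f ∘ u = g ∘ v),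
    a ∘ pb_pair h = u;
  pb_pair2 : forall (X : C) (u : X ~> A) (v : X ~> B) (h : f ∘ u = g ∘ v),
    b ∘ pb_pair h = v;
  pb_uniq : forall (X : C) (x y : X ~> P), a ∘ x = a ∘ y -> b ∘ x = b ∘ y ->
    x = y }.

Definition isTPullback (C : category) (T : endofunctor C) (P A B D : C)
    (f : A ~> D) (g : B ~> D) (a : P ~> A) (b : P ~> B) : Type :=
  forall k : nat,
    isPullback (fmap (functor_iter T k) f) (fmap (functor_iter T k) g)
               (fmap (functor_iter T k) a) (fmap (functor_iter T k) b).

(* [P], with structure map [r] to [M] and projections [pr], is the [n]-fold    *)
(* fibre product of [q] over [M], i.e. the [n]-th power of [q] in the slice    *)
(* over [M]; keeping [r] makes this correct for [n = 0] too.                   *)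
Record isFibrePower (C : category) (n : nat) (P E M : C) (q : E ~> M)
    (r : P ~> M) (pr : 'I_n -> (P ~> E)) : Type := IsFibrePower {
  fp_comm : forall i : 'I_n, q ∘ pr i = r;
  fp_pair : forall (X : C) (x : X ~> M) (f : 'I_n -> (X ~> E)),
    (forall i : 'I_n, q ∘ f i = x) -> (X ~> P);
  fp_pair_base : forall (X : C) (x : X ~> M) (f : 'I_n -> (X ~> E))
    (h : forall i : 'I_n, q ∘ f i = x), r ∘ fp_pair h = x;
  fp_pair_proj : forall (X : C) (x : X ~> M) (f : 'I_n -> (X ~> E))
    (h : forall i : 'I_n, q ∘ f i = x) (i : 'I_n), pr i ∘ fp_pair h = f i;
  fp_uniq : forall (X : C) (x y : X ~> P), r ∘ x = r ∘ y ->
    (forall i : 'I_n, pr i ∘ x = pr i ∘ y) -> x = y }.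

Record TFibrePower (C : category) (T : endofunctor C) (n : nat) (E M : C)
    (q : E ~> M) : Type := MkTFibrePower {
  fp_obj :> C;
  fp_base : fp_obj ~> M;
  fp_proj : 'I_n -> (fp_obj ~> E);
  fp_Tlimit : forall k : nat,
    isFibrePower (fmap (functor_iter T k) q) (fmap (functor_iter T k) fp_base)
                 (fun i => fmap (functor_iter T k) (fp_proj i)) }.

Arguments fp_base {C T n E M q} t : rename.
Arguments fp_proj {C T n E M q} t i : rename.
Arguments fp_Tlimit {C T n E M q} t k : rename.

Definition fp_fp (C : category) (T : endofunctor C) (n : nat) (E M : C)
    (q : E ~> M) (P : TFibrePower T n q) :
    isFibrePower q (fp_base P) (fp_proj P) := fp_Tlimit P 0.

Definition pi0 (C : category) (T : endofunctor C) (E M : C) (q : E ~> M)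
  (P : TFibrePower T 2 q) : P ~> E := fp_proj P ord0.
Definition pi1 (C : category) (T : endofunctor C) (E M : C) (q : E ~> M)
  (P : TFibrePower T 2 q) : P ~> E := fp_proj P ord_max.

Lemma fp_map_subproof (C : category) (T : endofunctor C) (n : nat)
    (E M E' M' : C) (q : E ~> M) (q' : E' ~> M') (P : TFibrePower T n q)
    (f1 : E ~> E') (f0 : M ~> M') (h : q' ∘ f1 = f0 ∘ q) (i : 'I_n) :
  q' ∘ (f1 ∘ fp_proj P i) = f0 ∘ fp_base P.
Proof. by rewrite comp_assoc h -comp_assoc (fp_comm (fp_fp P)). Qed.

Definition fp_map (C : category) (T : endofunctor C) (n : nat)
    (E M E' M' : C) (q : E ~> M) (q' : E' ~> M') (P : TFibrePower T n q)
    (P' : TFibrePower T n q') (f1 : E ~> E') (f0 : M ~> M')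
    (h : q' ∘ f1 = f0 ∘ q) : P ~> P' :=
  fp_pair (fp_fp P') (fp_map_subproof P h).

Record additiveData (C : category) (E M : C) (q : E ~> M) : Type :=
  AdditiveData {
  ad_two : C;
  ad_base : ad_two ~> M;
  ad_proj : 'I_2 -> (ad_two ~> E);
  ad_fp : isFibrePower q ad_base ad_proj;
  ad_plus : ad_two ~> E;
  ad_zero : M ~> E }.

Definition family2 (S : Type) (a b : S) (i : 'I_2) : S :=
  if i == ord0 then a else b.

Lemma family2_subproof (C : category) (X E M : C) (q : E ~> M)
    (a b : X ~> E) (h : q ∘ a = q ∘ b) (i : 'I_2) :
  q ∘ family2 a b i = q ∘ a.
Proof. by rewrite /family2; case: eqP. Qed.

(* The sum [a +_q b] of generalised elements in the same fibre. *)
Definition add (C : category) (E M : C) (q : E ~> M) (A : additiveData q)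
    (X : C) (a b : X ~> E) (h : q ∘ a = q ∘ b) : X ~> E :=
  ad_plus A ∘ fp_pair (ad_fp A) (family2_subproof h).
Arguments add {C E M q} A {X} a b h.

(* The commutative monoid laws in the slice over [M], on generalised elements. *)
Record isAdditiveBundle (C : category) (E M : C) (q : E ~> M)
    (A : additiveData q) : Prop := IsAdditiveBundle {
  ab_plus_over : q ∘ ad_plus A = ad_base A;
  ab_zero_over : q ∘ ad_zero A = idm M;
  ab_assoc : forall (X : C) (a b c : X ~> E)
    (hab : q ∘ a = q ∘ b) (hbc : q ∘ b = q ∘ c)
    (hl : q ∘ add A a b hab = q ∘ c) (hr : q ∘ a = q ∘ add A b c hbc),
    add A (add A a b hab) c hl = add A a (add A b c hbc) hr;
  ab_comm : forall (X : C) (a b : X ~> E)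
    (hab : q ∘ a = q ∘ b) (hba : q ∘ b = q ∘ a), add A a b hab = add A b a hba;
  ab_unit : forall (X : C) (a : X ~> E)
    (h : q ∘ a = q ∘ (ad_zero A ∘ (q ∘ a))),
    add A a (ad_zero A ∘ (q ∘ a)) h = a }.

Record isAdditiveMorphism (C : category) (E M E' M' : C) (q : E ~> M)
    (q' : E' ~> M') (A : additiveData q) (A' : additiveData q')
    (f1 : E ~> E') (f0 : M ~> M') : Prop := IsAdditiveMorphism {
  am_square : q' ∘ f1 = f0 ∘ q;
  am_add : forall (X : C) (a b : X ~> E) (h : q ∘ a = q ∘ b)
    (h' : q' ∘ (f1 ∘ a) = q' ∘ (f1 ∘ b)),
    f1 ∘ add A a b h = add A' (f1 ∘ a) (f1 ∘ b) h';
  am_zero : f1 ∘ ad_zero A = ad_zero A' ∘ f0 }.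

(* The operations on [q] given by [plus] and [zero], and their images on       *)
(* [T(q)]; both rely on the conversion of [functor_iter T 0] and               *)
(* [functor_iter T 1] with the identity and [T].                               *)
Section BundleData.
Variables (C : category) (T : endofunctor C) (E M : C) (q : E ~> M).
Variables (P : TFibrePower T 2 q) (plus : P ~> E) (zero : M ~> E).

Definition bundleData : additiveData q :=
  AdditiveData (fp_fp P) plus zero.

Definition TbundleData : additiveData (fmap T q) :=
  @AdditiveData C (T E) (T M) (fmap T q) (T P) (fmap T (fp_base P))
    (fun i => fmap T (fp_proj P i)) (fp_Tlimit P 1) (fmap T plus) (fmap T zero).

Variables (lam : E ~> T E) (zeroE : E ~> T E) (zeroM : M ~> T M).

Lemma vertical_lift_subproof (hlam : fmap T q ∘ lam = zeroM ∘ q)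
    (hzero : fmap T q ∘ zeroE = zeroM ∘ q) :
  fmap T q ∘ (lam ∘ pi0 P) = fmap T q ∘ (zeroE ∘ pi1 P).
Proof.
rewrite !comp_assoc hlam hzero -!comp_assoc; congr (_ ∘ _).
by rewrite (fp_comm (fp_fp P)) (fp_comm (fp_fp P)).
Qed.

(* [lam pi0 +_{T(q)} 0 pi1]. *)
Definition vertical_lift (hlam : fmap T q ∘ lam = zeroM ∘ q)
    (hzero : fmap T q ∘ zeroE = zeroM ∘ q) : P ~> T E :=
  add TbundleData (lam ∘ pi0 P) (zeroE ∘ pi1 P)
    (vertical_lift_subproof hlam hzero).

End BundleData.

Record tangentCategory : Type := TangentCategory {
  tan_cat :> category;
  Tan : endofunctor tan_cat;
  tan_p : forall M : tan_cat, Tan M ~> M;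
  tan_p_nat : forall (M N : tan_cat) (f : M ~> N),
    tan_p N ∘ fmap Tan f = f ∘ tan_p M;
  tan_pow : forall (n : nat) (M : tan_cat), TFibrePower Tan n (tan_p M);
  tan_zero : forall M : tan_cat, M ~> Tan M;
  tan_zero_nat : forall (M N : tan_cat) (f : M ~> N),
    fmap Tan f ∘ tan_zero M = tan_zero N ∘ f;
  tan_plus : forall M : tan_cat, tan_pow 2 M ~> Tan M;
  tan_plus_nat : forall (M N : tan_cat) (f : M ~> N),
    fmap Tan f ∘ tan_plus M
    = tan_plus N ∘ fp_map (tan_pow 2 M) (tan_pow 2 N) (tan_p_nat f);
  tan_lift : forall M : tan_cat, Tan M ~> Tan (Tan M);
  tan_lift_nat : forall (M N : tan_cat) (f : M ~> N),
    fmap Tan (fmap Tan f) ∘ tan_lift M = tan_lift N ∘ fmap Tan f;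
  tan_flip : forall M : tan_cat, Tan (Tan M) ~> Tan (Tan M);
  tan_flip_nat : forall (M N : tan_cat) (f : M ~> N),
    fmap Tan (fmap Tan f) ∘ tan_flip M = tan_flip N ∘ fmap Tan (fmap Tan f);
  tan_additive : forall M : tan_cat,
    isAdditiveBundle (bundleData (tan_plus M) (tan_zero M));
  tan_lift_additive : forall M : tan_cat,
    isAdditiveMorphism (bundleData (tan_plus M) (tan_zero M))
      (TbundleData (tan_plus M) (tan_zero M)) (tan_lift M) (tan_zero M);
  tan_flip_additive : forall M : tan_cat,
    isAdditiveMorphism (TbundleData (tan_plus M) (tan_zero M))
      (bundleData (tan_plus (Tan M)) (tan_zero (Tan M)))
      (tan_flip M) (idm (Tan M));
  tan_flip_flip : forall M : tan_cat,
    tan_flip M ∘ tan_flip M = idm (Tan (Tan M));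
  tan_flip_lift : forall M : tan_cat, tan_flip M ∘ tan_lift M = tan_lift M;
  tan_lift_lift : forall M : tan_cat,
    fmap Tan (tan_lift M) ∘ tan_lift M = tan_lift (Tan M) ∘ tan_lift M;
  tan_flip_braid : forall M : tan_cat,
    tan_flip (Tan M) ∘ fmap Tan (tan_flip M) ∘ tan_flip (Tan M)
    = fmap Tan (tan_flip M) ∘ tan_flip (Tan M) ∘ fmap Tan (tan_flip M);
  tan_lift_flip : forall M : tan_cat,
    fmap Tan (tan_lift M) ∘ tan_flip M
    = tan_flip (Tan M) ∘ fmap Tan (tan_flip M) ∘ tan_lift (Tan M);
  tan_universal : forall M : tan_cat,
    isTPullback Tan (fmap Tan (tan_p M)) (tan_zero M)
      (vertical_lift (tan_plus M) (tan_zero M)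
         (am_square (tan_lift_additive M)) (tan_zero_nat (tan_p M)))
      (tan_p M ∘ pi0 (tan_pow 2 M)) }.

Arguments Tan {t}.
Arguments tan_p {t} M.
Arguments tan_pow {t} n M.
Arguments tan_zero {t} M.
Arguments tan_plus {t} M.
Arguments tan_lift {t} M.
Arguments tan_flip {t} M.

Definition tan_data (C : tangentCategory) (M : C) :
    additiveData (tan_p M) := bundleData (tan_plus M) (tan_zero M).
Arguments tan_data {C} M.

Record negatives (C : tangentCategory) : Type := Negatives {
  neg : forall M : C, Tan M ~> Tan M;
  neg_nat : forall (M N : C) (f : M ~> N),
    fmap Tan f ∘ neg M = neg N ∘ fmap Tan f;
  neg_over : forall M : C, tan_p M ∘ neg M = tan_p M;
  neg_inverse : forall (M X : C) (a : X ~> Tan M)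
    (h : tan_p M ∘ a = tan_p M ∘ (neg M ∘ a)),
    add (tan_data M) a (neg M ∘ a) h = tan_zero M ∘ (tan_p M ∘ a) }.

Lemma sub_subproof (C : tangentCategory) (N : negatives C) (M X : C)
    (a b : X ~> Tan M) (h : tan_p M ∘ a = tan_p M ∘ b) :
  tan_p M ∘ a = tan_p M ∘ (neg N M ∘ b).
Proof. by rewrite comp_assoc neg_over. Qed.

Definition sub (C : tangentCategory) (N : negatives C) (M X : C)
    (a b : X ~> Tan M) (h : tan_p M ∘ a = tan_p M ∘ b) : X ~> Tan M :=
  add (tan_data M) a (neg N M ∘ b) (sub_subproof N h).
Arguments sub {C} N {M X} a b h.

Record isPreDifferentialBundle (C : tangentCategory) (E M : C) (q : E ~> M)
    (xi : M ~> E) (lam : E ~> Tan E) : Prop := IsPreDifferentialBundle {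
  pdb_section : q ∘ xi = idm M;
  pdb_coassoc : tan_lift E ∘ lam = fmap Tan lam ∘ lam;
  pdb_lift_p : tan_p E ∘ lam = xi ∘ q;
  pdb_lift_zero : lam ∘ xi = tan_zero E ∘ xi }.

Record differentialBundle (C : tangentCategory) (E M : C) (q : E ~> M)
    (xi : M ~> E) (lam : E ~> Tan E) : Type := DifferentialBundle {
  db_pre : isPreDifferentialBundle q xi lam;
  db_pow : forall n : nat, TFibrePower Tan n q;
  db_plus : db_pow 2 ~> E;
  db_additive : isAdditiveBundle (bundleData db_plus xi);
  db_lift_additive : isAdditiveMorphism (bundleData db_plus xi)
    (TbundleData db_plus xi) lam (tan_zero M);
  db_lift_additive_p : isAdditiveMorphism (bundleData db_plus xi)
    (tan_data E) lam xi;
  db_universal : isTPullback Tan (fmap Tan q) (tan_zero M)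
    (vertical_lift db_plus xi (am_square db_lift_additive) (tan_zero_nat q))
    (q ∘ pi0 (db_pow 2)) }.

(* [(f1, f0)] is linear from [q], with lift [lam], to [q'], with lift [lam']. *)
Record isLinearMorphism (C : tangentCategory) (E M E' M' : C)
    (q : E ~> M) (lam : E ~> Tan E) (q' : E' ~> M') (lam' : E' ~> Tan E')
    (f1 : E ~> E') (f0 : M ~> M') : Prop := IsLinearMorphism {
  lm_square : q' ∘ f1 = f0 ∘ q;
  lm_lift : fmap Tan f1 ∘ lam = lam' ∘ f1 }.

Lemma iota_fibre (C : tangentCategory) (E M TME : C) (q : E ~> M)
    (xi : M ~> E) (lam : E ~> Tan E) (D : differentialBundle q xi lam)
    (piM : TME ~> M) (iotaM : TME ~> Tan E)
    (PB : isPullback (tan_p E) xi iotaM piM) :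
  tan_p E ∘ iotaM = tan_p E ∘ (fmap Tan (xi ∘ q) ∘ iotaM).
Proof.
rewrite comp_assoc tan_p_nat -comp_assoc (pb_comm PB) -!comp_assoc (comp_assoc q).
by rewrite (pdb_section (db_pre D)) comp_idl.
Qed.

(* Main.v *)
From mathcomp Require Import all_boot.
Require Import Defs.

(** Subtracting from [iotaM] its horizontal part [T(ξ q) iotaM] leaves a
    vertical vector: [iotaM χ] is killed by [T(q)], and its base point is still
    [ξ piM].  The universality square of the differential bundle [q] says that
    [λ] identifies [E] with exactly these vectors: an element of the kernel of
    [T(q)] is [λ a +_{T(q)} 0 b] for unique [a] and [b] in one fibre, its base
    point is [ξ q a +_q b = b], and if this is a zero of [q] then the second
    summand vanishes ([lift_factor], [lift_monic]).  Hence [iotaM χ = λ K] for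
    a unique [K] over [M], which is the factorisation of [χ] through [(λ, q)].

    Conversely [λ] is already vertical: [T(ξ q) λ] is the zero vector at
    [p λ = ξ q], so that [λ K (λ, q) = λ - 0 = λ], and [K (λ, q) = id] because
    [λ] is monic.  That [χ] is idempotent and that [K] is unique then follow
    from [χ = (λ, q) K] and this retraction.

    The supporting computations express that [T(f)] preserves differences and
    that [p : T(q) -> q] preserves sums; both are instances of [add_natural]. *)

(** * Sums of generalised elements *)

Lemma add_congr {C : category} {E M : C} {q : E ~> M} (A : additiveData q)
    {X : C} {a b a' b' : X ~> E} (h : q ∘ a = q ∘ b) (h' : q ∘ a' = q ∘ b') :
  a = a' -> b = b' -> add A a b h = add A a' b' h'.
Proof.
move=> ea eb; congr (_ ∘ _); apply: (fp_uniq (ad_fp A)).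
  by rewrite !fp_pair_base ea.
by move=> i; rewrite !fp_pair_proj ea eb.
Qed.

Lemma add_comp {C : category} {E M : C} {q : E ~> M} (A : additiveData q)
    {X Y : C} {a b : X ~> E} (h : q ∘ a = q ∘ b) (y : Y ~> X)
    (h' : q ∘ (a ∘ y) = q ∘ (b ∘ y)) :
  add A a b h ∘ y = add A (a ∘ y) (b ∘ y) h'.
Proof.
rewrite /add -comp_assoc; congr (_ ∘ _); apply: (fp_uniq (ad_fp A)).
  by rewrite comp_assoc !fp_pair_base comp_assoc.
move=> i; rewrite comp_assoc !fp_pair_proj.
by rewrite /family2; case: eqP.
Qed.

(** The pointwise form of additivity, for operations that [f1] intertwines along
    a map [f2] of fibre squares lying over [f1] on each factor. *)
Lemma add_natural {C : category} {E M E' M' : C} {q : E ~> M} {q' : E' ~> M'}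
    {A : additiveData q} {A' : additiveData q'}
    {f1 : E ~> E'} {f0 : M ~> M'} {f2 : ad_two A ~> ad_two A'} :
  ad_base A' ∘ f2 = f0 ∘ ad_base A ->
  (forall i, ad_proj A' i ∘ f2 = f1 ∘ ad_proj A i) ->
  f1 ∘ ad_plus A = ad_plus A' ∘ f2 -> q' ∘ f1 = f0 ∘ q ->
  forall (X : C) (a b : X ~> E) (h : q ∘ a = q ∘ b)
    (h' : q' ∘ (f1 ∘ a) = q' ∘ (f1 ∘ b)),
  f1 ∘ add A a b h = add A' (f1 ∘ a) (f1 ∘ b) h'.
Proof.
move=> f2_base f2_proj f1_plus f1_over X a b h h'.
rewrite /add comp_assoc f1_plus -comp_assoc; congr (_ ∘ _).
apply: (fp_uniq (ad_fp A')).
  by rewrite comp_assoc f2_base -comp_assoc !fp_pair_base !comp_assoc f1_over.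
move=> i; rewrite comp_assoc f2_proj -comp_assoc !fp_pair_proj.
by rewrite /family2; case: eqP.
Qed.

Lemma add_zero {C : category} {E M : C} {q : E ~> M} {A : additiveData q}
    (HA : isAdditiveBundle A) {X : C} {a : X ~> E} {m : X ~> M}
    (h : q ∘ a = q ∘ (ad_zero A ∘ m)) :
  add A a (ad_zero A ∘ m) h = a.
Proof.
have em : m = q ∘ a by rewrite h comp_assoc (ab_zero_over HA) comp_idl.
by move: h; rewrite {}em => h; apply: ab_unit.
Qed.

Lemma zero_add {C : category} {E M : C} {q : E ~> M} {A : additiveData q}
    (HA : isAdditiveBundle A) {X : C} {a : X ~> E} {m : X ~> M}
    (h : q ∘ (ad_zero A ∘ m) = q ∘ a) :
  add A (ad_zero A ∘ m) a h = a.
Proof. by rewrite (ab_comm HA h (esym h)) (add_zero HA). Qed.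

(** The unit law of [T(q)] has to be read off from its universal instance, with
    [a] the identity of [T E], since a generalised element of [T E] need not be
    the image of one of [E]. *)
Lemma Tbundle_add_zero {C : category} {T : endofunctor C} {E M : C} {q : E ~> M}
    {P : TFibrePower T 2 q} {plus : P ~> E} {zero : M ~> E}
    (HA : isAdditiveBundle (bundleData plus zero))
    {X : C} {a : X ~> T E} {m : X ~> T M}
    (h : fmap T q ∘ a = fmap T q ∘ (fmap T zero ∘ m)) :
  add (TbundleData plus zero) a (fmap T zero ∘ m) h = a.
Proof.
have em : m = fmap T q ∘ a.
  rewrite h comp_assoc -fmap_comp (ab_zero_over HA).
  by rewrite fmap_id comp_idl.
have hu : q ∘ idm E = q ∘ (zero ∘ (q ∘ idm E)).
  by rewrite comp_assoc (ab_zero_over HA) comp_idl.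
have /(congr1 (fun z => fmap T z)) := ab_unit HA hu.
rewrite {1}/add fmap_comp fmap_id => /(congr1 (fun z => z ∘ a)).
rewrite comp_idl -comp_assoc => eu; rewrite -[RHS]eu; congr (_ ∘ _).
apply: (fp_uniq (fp_Tlimit P 1)) => [|i].
  rewrite fp_pair_base [RHS]comp_assoc /= -fmap_comp fp_pair_base.
  by rewrite comp_idr.
rewrite fp_pair_proj [RHS]comp_assoc /= -fmap_comp fp_pair_proj /family2.
case: eqP => _; first by rewrite fmap_id comp_idl.
by rewrite em comp_idr fmap_comp comp_assoc.
Qed.

(** * Differences of tangent vectors *)

Section Tangent.

Context {C : tangentCategory} {N : negatives C}.

Lemma tan_p_zero (M : C) : tan_p M ∘ tan_zero M = idm M.
Proof. exact: (ab_zero_over (tan_additive M)). Qed.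

Lemma tan_add (E M : C) (f : E ~> M) (X : C) (a b : X ~> Tan E)
    (h : tan_p E ∘ a = tan_p E ∘ b)
    (h' : tan_p M ∘ (fmap Tan f ∘ a) = tan_p M ∘ (fmap Tan f ∘ b)) :
  fmap Tan f ∘ add (tan_data E) a b h
  = add (tan_data M) (fmap Tan f ∘ a) (fmap Tan f ∘ b) h'.
Proof.
apply: (add_natural (A := tan_data E) (A' := tan_data M) (f0 := f)
          (f2 := fp_map (tan_pow 2 E) (tan_pow 2 M) (tan_p_nat f))).
- exact: fp_pair_base.
- by move=> i; apply: fp_pair_proj.
- exact: tan_plus_nat.
- exact: tan_p_nat.
Qed.

Lemma tan_p_sub (M X : C) (a b : X ~> Tan M) (h : tan_p M ∘ a = tan_p M ∘ b) :
  tan_p M ∘ sub N a b h = tan_p M ∘ a.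
Proof.
rewrite /sub /add comp_assoc (ab_plus_over (tan_additive M)).
exact: fp_pair_base.
Qed.

Lemma sub_comp {M X Y : C} {a b : X ~> Tan M} (h : tan_p M ∘ a = tan_p M ∘ b)
    (y : Y ~> X) (h' : tan_p M ∘ (a ∘ y) = tan_p M ∘ (b ∘ y)) :
  sub N a b h ∘ y = sub N (a ∘ y) (b ∘ y) h'.
Proof.
rewrite /sub add_comp => [|h1]; last by apply: add_congr; rewrite ?comp_assoc.
by rewrite -comp_assoc h' !comp_assoc neg_over.
Qed.

Lemma tan_sub (E M : C) (f : E ~> M) (X : C) (a b : X ~> Tan E)
    (h : tan_p E ∘ a = tan_p E ∘ b)
    (h' : tan_p M ∘ (fmap Tan f ∘ a) = tan_p M ∘ (fmap Tan f ∘ b)) :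
  fmap Tan f ∘ sub N a b h = sub N (fmap Tan f ∘ a) (fmap Tan f ∘ b) h'.
Proof.
rewrite /sub tan_add => [|h1].
  by rewrite !comp_assoc tan_p_nat -!comp_assoc (sub_subproof N h).
by apply: add_congr => //; rewrite !comp_assoc neg_nat.
Qed.

Lemma sub_self {M X : C} {a b : X ~> Tan M} (h : tan_p M ∘ a = tan_p M ∘ b) :
  a = b -> sub N a b h = tan_zero M ∘ (tan_p M ∘ a).
Proof. by move=> eab; subst b; apply: neg_inverse. Qed.

Lemma neg_zero (M : C) : neg N M ∘ tan_zero M = tan_zero M.
Proof.
have h : tan_p M ∘ tan_zero M = tan_p M ∘ (neg N M ∘ tan_zero M).
  by rewrite comp_assoc neg_over.
have sum0 := neg_inverse h; rewrite tan_p_zero comp_idr in sum0.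
have h0 : tan_p M ∘ (tan_zero M ∘ idm M) = tan_p M ∘ (neg N M ∘ tan_zero M).
  by rewrite comp_idr.
rewrite -[RHS]sum0 -[LHS](zero_add (tan_additive M) h0).
by apply: add_congr => //; apply: comp_idr.
Qed.

Lemma sub_zero {M X : C} {a b : X ~> Tan M} {m : X ~> M}
    (h : tan_p M ∘ a = tan_p M ∘ b) :
  b = tan_zero M ∘ m -> sub N a b h = a.
Proof.
move=> eb; subst b.
have eb : neg N M ∘ (tan_zero M ∘ m) = tan_zero M ∘ m.
  by rewrite comp_assoc neg_zero.
have h0 : tan_p M ∘ a = tan_p M ∘ (tan_zero M ∘ m) by [].
by rewrite -[RHS](add_zero (tan_additive M) h0); apply: add_congr.
Qed.

End Tangent.

(** * The lift of a differential bundle as a kernel of [T(q)] *)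

Section Lift.

Context {C : tangentCategory} {E M : C} {q : E ~> M} {xi : M ~> E}.
Context {lam : E ~> Tan E} (D : differentialBundle q xi lam).

(** Naturality of [p] at the addition of [q]. *)
Lemma tan_p_add (X : C) (a b : X ~> Tan E) (h : fmap Tan q ∘ a = fmap Tan q ∘ b)
    (h' : q ∘ (tan_p E ∘ a) = q ∘ (tan_p E ∘ b)) :
  tan_p E ∘ add (TbundleData (db_plus D) xi) a b h
  = add (bundleData (db_plus D) xi) (tan_p E ∘ a) (tan_p E ∘ b) h'.
Proof.
apply: (add_natural (A := TbundleData (db_plus D) xi)
          (A' := bundleData (db_plus D) xi) (f0 := tan_p M)
          (f2 := tan_p (db_pow D 2))).
- by rewrite /= tan_p_nat.
- by move=> i; rewrite /= tan_p_nat.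
- by rewrite /= tan_p_nat.
- by rewrite tan_p_nat.
Qed.

Let vl := vertical_lift (db_plus D) xi (am_square (db_lift_additive D))
            (tan_zero_nat q).

Let vl_pullback : isPullback (fmap Tan q) (tan_zero M) vl (q ∘ pi0 (db_pow D 2))
  := db_universal D 0.

Lemma pow2_over {X : C} (w : X ~> db_pow D 2) :
  q ∘ (pi0 (db_pow D 2) ∘ w) = q ∘ (pi1 (db_pow D 2) ∘ w).
Proof.
rewrite !comp_assoc; congr (_ ∘ _).
by rewrite !(fp_comm (fp_fp (db_pow D 2))).
Qed.

Lemma lift_over {X : C} {a b : X ~> E} : q ∘ a = q ∘ b ->
  fmap Tan q ∘ (lam ∘ a) = fmap Tan q ∘ (tan_zero E ∘ b).
Proof.
move=> h; rewrite !comp_assoc (am_square (db_lift_additive D)) tan_zero_nat.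
by rewrite -!comp_assoc h.
Qed.

Lemma vertical_lift_comp {X : C} {w : X ~> db_pow D 2}
    (h : fmap Tan q ∘ (lam ∘ (pi0 (db_pow D 2) ∘ w))
         = fmap Tan q ∘ (tan_zero E ∘ (pi1 (db_pow D 2) ∘ w))) :
  vl ∘ w = add (TbundleData (db_plus D) xi) (lam ∘ (pi0 (db_pow D 2) ∘ w))
             (tan_zero E ∘ (pi1 (db_pow D 2) ∘ w)) h.
Proof.
rewrite /vl /vertical_lift add_comp => [|h1].
  by rewrite -!comp_assoc h.
by apply: add_congr; rewrite comp_assoc.
Qed.

(** The second component of a vertical lift is its base point: [p] sends the
    first summand to [ξ q a], which is neutral for [+_q]. *)
Lemma tan_p_vertical_lift {X : C} (w : X ~> db_pow D 2) :
  tan_p E ∘ (vl ∘ w) = pi1 (db_pow D 2) ∘ w.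
Proof.
have h := pow2_over w.
rewrite (vertical_lift_comp (lift_over h)).
have e0 : tan_p E ∘ (lam ∘ (pi0 (db_pow D 2) ∘ w))
          = xi ∘ (q ∘ (pi0 (db_pow D 2) ∘ w)).
  by rewrite comp_assoc (pdb_lift_p (db_pre D)) !comp_assoc.
have e1 : tan_p E ∘ (tan_zero E ∘ (pi1 (db_pow D 2) ∘ w))
          = pi1 (db_pow D 2) ∘ w.
  by rewrite comp_assoc tan_p_zero comp_idl.
have h0 : q ∘ (xi ∘ (q ∘ (pi0 (db_pow D 2) ∘ w)))
          = q ∘ (pi1 (db_pow D 2) ∘ w).
  by rewrite comp_assoc (pdb_section (db_pre D)) comp_idl.
rewrite tan_p_add => [|h1]; first by rewrite e0 e1.
rewrite -[RHS](zero_add (db_additive D) h0).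
exact: add_congr.
Qed.

(** A tangent vector [0 ξ m] is [T(ξ) 0 m], a zero for the fibrewise addition of
    [T(q)], so that only the summand [λ] of the vertical lift remains. *)
Lemma vertical_lift_zero {X : C} {w : X ~> db_pow D 2} {m : X ~> M} :
  pi1 (db_pow D 2) ∘ w = xi ∘ m -> vl ∘ w = lam ∘ (pi0 (db_pow D 2) ∘ w).
Proof.
move=> ew; rewrite (vertical_lift_comp (lift_over (pow2_over w))).
have e1 : tan_zero E ∘ (pi1 (db_pow D 2) ∘ w)
          = fmap Tan xi ∘ (tan_zero M ∘ m).
  by rewrite ew !comp_assoc tan_zero_nat.
have h0 := lift_over (pow2_over w); rewrite e1 in h0.
transitivity (add (TbundleData (db_plus D) xi)
                (lam ∘ (pi0 (db_pow D 2) ∘ w)) _ h0).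
  exact: add_congr.
exact (Tbundle_add_zero (db_additive D) h0).
Qed.

(** With [ξ m] as second component, the universality square exhibits [λ] as
    the part of the kernel of [T(q)] whose base points are zeros of [q]. *)
Lemma lift_factor {X : C} {u : X ~> Tan E} {m : X ~> M} :
  fmap Tan q ∘ u = tan_zero M ∘ m -> tan_p E ∘ u = xi ∘ m ->
  exists k : X ~> E, lam ∘ k = u.
Proof.
move=> uq up; pose w := pb_pair vl_pullback uq.
have ew : vl ∘ w = u by apply: pb_pair1.
exists (pi0 (db_pow D 2) ∘ w).
rewrite -(vertical_lift_zero (m := m)) //.
by rewrite -up -ew tan_p_vertical_lift.
Qed.

Lemma lift_base {X : C} (x : X ~> E) : q ∘ (tan_p E ∘ (lam ∘ x)) = q ∘ x.
Proof.
rewrite [tan_p E ∘ _]comp_assoc (pdb_lift_p (db_pre D)) !comp_assoc.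
by rewrite (pdb_section (db_pre D)) comp_idl.
Qed.

(** [λ x] is the vertical lift of the pair [(x, ξ q x)], and it determines both
    the pair, by universality, and the base point [q x = q p λ x] that the
    universality square asks for. *)
Lemma lift_monic {X : C} {x y : X ~> E} : lam ∘ x = lam ∘ y -> x = y.
Proof.
move=> h.
have exy : q ∘ x = q ∘ y by rewrite -lift_base h lift_base.
have zero_over (z : X ~> E) : q ∘ z = q ∘ (xi ∘ (q ∘ z)).
  by rewrite !comp_assoc (pdb_section (db_pre D)) comp_idl.
pose w (z : X ~> E) := fp_pair (fp_fp (db_pow D 2))
                         (family2_subproof (zero_over z)).
have w0 z : pi0 (db_pow D 2) ∘ w z = z.
  exact: (fp_pair_proj (fp_fp (db_pow D 2)) _ ord0).
have w1 z : pi1 (db_pow D 2) ∘ w z = xi ∘ (q ∘ z).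
  exact: (fp_pair_proj (fp_fp (db_pow D 2)) _ ord_max).
suff ew : w x = w y by rewrite -(w0 x) ew w0.
apply: (pb_uniq vl_pullback); last by rewrite -!comp_assoc !w0.
by rewrite !(vertical_lift_zero (w1 _)) !w0 h.
Qed.

End Lift.

(** * The retraction *)

Theorem corollary3p1p3 (C : tangentCategory) (N : negatives C)
    (E M TME : C) (q : E ~> M) (xi : M ~> E) (lam : E ~> Tan E)
    (D : differentialBundle q xi lam)
    (piM : TME ~> M) (iotaM : TME ~> Tan E)
    (PB : isPullback (tan_p E) xi iotaM piM)
    (xiM : M ~> TME) (lamM : TME ~> Tan TME)
    (DM : differentialBundle piM xiM lamM)
    (L : isLinearMorphism piM lamM (tan_p E) (tan_lift E) iotaM xi) :
  exists (chi : TME ~> TME) (lamq : E ~> TME) (K : TME ~> E),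
    unique (fun x : TME ~> TME => iotaM ∘ x
      = sub N iotaM (fmap Tan (xi ∘ q) ∘ iotaM) (iota_fibre D PB)) chi
    /\ chi ∘ chi = chi
    /\ unique (fun x : E ~> TME => iotaM ∘ x = lam /\ piM ∘ x = q) lamq
    /\ unique (fun k : TME ~> E => lamq ∘ k = chi) K
    /\ q ∘ K = piM
    /\ piM ∘ lamq = q
    /\ K ∘ lamq = idm E.
Proof.
have section_q : q ∘ xi = idm M := pdb_section (db_pre D).
have p_lam : tan_p E ∘ lam = xi ∘ q := pdb_lift_p (db_pre D).
have Tq_lam : fmap Tan q ∘ lam = tan_zero M ∘ q.
  exact: am_square (db_lift_additive D).
pose vert := sub N iotaM (fmap Tan (xi ∘ q) ∘ iotaM) (iota_fibre D PB).
have p_vert : tan_p E ∘ vert = xi ∘ piM by rewrite tan_p_sub (pb_comm PB).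
(* [T(q) T(ξ q) = T(q)], so the two terms of [vert] have the same image. *)
have Tq_vert : fmap Tan q ∘ vert = tan_zero M ∘ piM.
  have eq_Tq : fmap Tan q ∘ iotaM
               = fmap Tan q ∘ (fmap Tan (xi ∘ q) ∘ iotaM).
    by rewrite [RHS]comp_assoc -fmap_comp comp_assoc section_q comp_idl.
  rewrite tan_sub => [|h]; first by rewrite -eq_Tq.
  rewrite (sub_self _ eq_Tq); congr (_ ∘ _).
  rewrite comp_assoc tan_p_nat -comp_assoc (pb_comm PB).
  by rewrite comp_assoc section_q comp_idl.
have [K lam_K] := lift_factor D Tq_vert p_vert.
have q_K : q ∘ K = piM.
  by rewrite -(lift_base D) lam_K p_vert comp_assoc section_q comp_idl.
pose chi := pb_pair PB p_vert.
have iota_chi : iotaM ∘ chi = vert by apply: pb_pair1.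
have pi_chi : piM ∘ chi = piM by apply: pb_pair2.
pose lamq := pb_pair PB p_lam.
have iota_lamq : iotaM ∘ lamq = lam by apply: pb_pair1.
have pi_lamq : piM ∘ lamq = q by apply: pb_pair2.
have lamq_K : lamq ∘ K = chi.
  apply: (pb_uniq PB); rewrite comp_assoc.
    by rewrite iota_lamq lam_K.
  by rewrite pi_lamq q_K.
have K_lamq : K ∘ lamq = idm E.
  apply: (lift_monic D); rewrite comp_idr comp_assoc lam_K.
  (* [λ] is vertical, so it has no horizontal part to be subtracted. *)
  have T_lam : (fmap Tan (xi ∘ q) ∘ iotaM) ∘ lamq = tan_zero E ∘ (xi ∘ q).
    rewrite -comp_assoc iota_lamq fmap_comp -comp_assoc Tq_lam.
    by rewrite !comp_assoc tan_zero_nat.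
  rewrite /vert sub_comp => [|h]; last by rewrite (sub_zero _ T_lam).
  by rewrite !comp_assoc (iota_fibre D PB) !comp_assoc.
exists chi, lamq, K; split.
  split=> // x iota_x; apply: (pb_uniq PB); first by rewrite iota_chi iota_x.
  have /(congr1 (fun z => q ∘ z)) : xi ∘ (piM ∘ x) = xi ∘ piM.
    by rewrite -p_vert /vert -iota_x !comp_assoc (pb_comm PB).
  by rewrite !comp_assoc section_q !comp_idl pi_chi.
split.
  by rewrite -lamq_K comp_assoc -(comp_assoc lamq K) K_lamq comp_idr.
split.
  split=> // x [iota_x pi_x].
  by apply: (pb_uniq PB); rewrite ?iota_lamq ?pi_lamq.
split=> //; split=> // k lamq_k.
rewrite -[LHS]comp_idl -[RHS]comp_idl -K_lamq.
by rewrite -!comp_assoc lamq_K lamq_k.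
Qed.
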